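(* Let $(A,\sigma)$ be a semilocal ring with involution such that $2\in A^\times$. Write $\bar A=A/\mathrm{Jac}\,A$, denote the quotient map by $a\mapsto \bar a$, and let $\bar\sigma$ be the involution of $\bar A$ given by $\bar a^{\bar\sigma}=\overline{a^\sigma}$. Then the image of the map $u\mapsto \bar u: U(A,\sigma)\to U(\bar A,\bar\sigma)$ contains $U^0(\bar A,\bar\sigma)$.
   Context: A ring $A$ is semilocal if $A/\mathrm{Jac}\,A$ is semisimple artinian, where $\mathrm{Jac}\,A$ is the Jacobson radical. An involution of a ring is an additive anti-automorphism of order at most $2$. For a ring with involution $(A,\sigma)$, $U(A,\sigma)=\{u\in A: u^\sigma u=1\}$. For a semisimple artinian ring with involution $(A,\sigma)$, the subgroup $U^0(A,\sigma)\subseteq U(A,\sigma)$ is defined as follows. If $A$ is simple artinian, identify $A\cong M_n(D)$ with $D$ a division ring with center $K$; then $U^0(A,\sigma)=\mathrm{SO}(A,\sigma)=\{u\in U(A,\sigma):\det u=1\}$ if $D=K$ and $\sigma$ is an orthogonal involution (a $K$-linear involution of $M_n(K)$ adjoint to a symmetric nondegenerate bilinear form), and $U^0(A,\sigma)=U(A,\sigma)$ otherwise. If $A=B\times B^{\mathrm{op}}$ with $B$ simple artinian and $(x,y^{\mathrm{op}})^\sigma=(y,x^{\mathrm{op}})$, then $U^0(A,\sigma)=U(A,\sigma)$. In general, $(A,\sigma)$ factors essentially uniquely as $\prod_{i=1}^t(A_i,\sigma_i)$ with each factor of exactly one of the two previous kinds, and $U^0(A,\sigma)=\prod_i U^0(A_i,\sigma_i)$.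 *)

(* Defs.v *)
From HB Require Import structures.
From mathcomp Require Import all_boot all_order all_algebra.
Set Implicit Arguments. Unset Strict Implicit. Unset Printing Implicit Defensive.
Import GRing.Theory.
Local Open Scope ring_scope.

Section RingDefs.
Variable R : pzRingType.

Definition is_involution (s : R -> R) : Prop :=
  [/\ forall x y, s (x + y) = s x + s y,
      forall x y, s (x * y) = s y * s x &
      forall x, s (s x) = x].

Definition is_left_ideal (L : R -> Prop) : Prop :=
  [/\ L 0, forall x y, L x -> L y -> L (x + y) &
      forall a x, L x -> L (a * x)].

Definition is_ideal (I : R -> Prop) : Prop :=
  [/\ I 0, forall x y, I x -> I y -> I (x + y),
      forall a x, I x -> I (a * x) &
      forall a x, I x -> I (x * a)].

Definition is_maximal_left_ideal (L : R -> Prop) : Prop :=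
  [/\ is_left_ideal L, ~ L 1 &
      forall L', is_left_ideal L' -> (forall x, L x -> L' x) -> ~ L' 1 ->
        forall x, L' x -> L x].

Definition jacobson (x : R) : Prop :=
  forall L, is_maximal_left_ideal L -> L x.

Definition semisimple : Prop :=
  forall L, is_left_ideal L ->
    exists L', [/\ is_left_ideal L',
                   forall x, L x -> L' x -> x = 0 &
                   forall x, exists y z, [/\ L y, L' z & x = y + z]].

Definition central (e : R) : Prop := forall x, e * x = x * e.

(* for a central idempotent e, the factor ring eR (identity e) is simple:
   nonzero, and its only two-sided ideals are 0 and eR (the ideals of eR are
   exactly the ideals of R contained in eR) *)
Definition simple_factor (e : R) : Prop :=
  e <> 0 /\
  forall I, is_ideal I -> (forall x, I x -> e * x = x) ->
    (forall x, I x -> x = 0) \/ (forall x, e * x = x -> I x).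

(* the factor (eR, s) is of the form (B x B^op, exchange involution):
   e = f + s f with f central idempotent, f * s f = 0 and fR simple *)
Definition exchange_factor (s : R -> R) (e : R) : Prop :=
  exists f, [/\ central f, f * f = f, f * s f = 0, e = f + s f & simple_factor f].

Definition ring_iso_onto (K : fieldType) (n : nat) (phi : 'M[K]_n -> R) (e : R) :
  Prop :=
  [/\ forall X Y, phi (X + Y) = phi X + phi Y,
      forall X Y, phi (X *m Y) = phi X * phi Y,
      phi 1%:M = e,
      injective phi &
      forall y, e * y = y -> exists X, phi X = y].

(* transported through phi, s is the orthogonal involution of M_n(K) adjoint
   to the symmetric nondegenerate bilinear form (x,y) |-> x^T S y *)
Definition orthogonal_via (K : fieldType) (n : nat) (phi : 'M[K]_n -> R)
  (S : 'M[K]_n) (s : R -> R) : Prop :=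
  [/\ S^T = S, S \in unitmx &
      forall X, s (phi X) = phi (invmx S *m X^T *m S)].

Definition unitary (s : R -> R) (u : R) : Prop := s u * u = 1.

(* U^0(R,s) for R semisimple artinian: R = prod_i e_i R, with (e_i R, s) either
   simple or of exchange type; on simple factors identified with M_n(K)
   (K = D a field) with s orthogonal, the component must have determinant 1. *)
Definition U0 (s : R -> R) (u : R) : Prop :=
  unitary s u /\
  exists (t : nat) (e : 'I_t -> R),
    [/\ forall i, central (e i) /\ e i * e i = e i,
        forall i j, i != j -> e i * e j = 0,
        \sum_(i < t) e i = 1,
        forall i, s (e i) = e i /\
                  (simple_factor (e i) \/ exchange_factor s (e i)) &
        forall i (K : fieldType) (n : nat) (phi : 'M[K]_n -> R) (S : 'M[K]_n),
          simple_factor (e i) -> ring_iso_onto phi (e i) ->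
          orthogonal_via phi S s ->
          forall X, phi X = e i * u -> \det X = 1].

End RingDefs.

(* Main.v *)
Require Import Defs.
From HB Require Import structures.
From mathcomp Require Import all_boot all_order all_algebra.
From mathcomp Require Import boolp classical_sets.
Set Implicit Arguments. Unset Strict Implicit. Unset Printing Implicit Defensive.
Import GRing.Theory.
Local Open Scope ring_scope.
Local Open Scope classical_set_scope.

(** For [y] and a unit [c] with [c + s c = s y * y], the element
    [y c^-1 s(y) - 1] is unitary. Such data lift from [B] to [A]: lift [y] to
    [Y] and [c] to [C0] arbitrarily, and take
    [C = (s(Y) Y + C0 - s(C0)) / 2], which is a unit because it is one modulo
    the radical. So it suffices to write every [v] in [U^0] in this form, one
    simple or exchange component at a time.

    On a component [e] put [a = e (1 + v)], with reflexive inverse [h]. Wall's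
    form on the image of [a] provides [c] on that image, and [c] extends to a
    unit as soon as the complementary module [(e - a h) B] carries a unimodular
    skew-hermitian form. If some primitive idempotent [f] carries no such form,
    then all forms on [f B] are symmetric, so [f B f] is a field and the
    component is [M_n(K)] with an orthogonal involution. There
    [det(- v) = (-1)^(rank (1 + v))], so [det v = 1] makes
    [n - rank (1 + v)] even and an alternating form does the job. On an exchange
    component, [v = (x, x^-1)], [y = (1 + x, 1)] and [c = (1, x)] work. *)

(** * Matrices over a field *)

Section MatrixLemmas.
Variable K : fieldType.

(** Sylvester's identity: two triangular factorisations of one block matrix. *)
Lemma det_sub_mulmxC (m n : nat) (L : 'M[K]_(n, m)) (M : 'M[K]_(m, n)) :
  \det (1%:M - L *m M) = \det (1%:M - M *m L).
Proof.
transitivity (\det (block_mx 1%:M M L 1%:M)).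
  have -> : block_mx 1%:M M L 1%:M =
      block_mx 1%:M 0 L 1%:M *m block_mx 1%:M M 0 (1%:M - L *m M).
    by rewrite mulmx_block !(mul1mx, mulmx1, mulmx0, mul0mx, addr0) addrC subrK.
  by rewrite det_mulmx det_lblock det_ublock !det1 !mul1r.
have -> : block_mx 1%:M M L 1%:M =
    block_mx (1%:M - M *m L) M 0 1%:M *m block_mx 1%:M 0 L 1%:M.
  by rewrite mulmx_block !(mul1mx, mulmx1, mulmx0, mul0mx, add0r) subrK.
by rewrite det_mulmx det_lblock det_ublock !det1 !mulr1.
Qed.

Lemma mxrank_1sub_idem (n : nat) (P : 'M[K]_n) :
  P *m P = P -> \rank (1%:M - P) = (n - \rank P)%N.
Proof.
move=> PP; apply/eqP; rewrite eqn_leq leq_subLR; apply/andP; split.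
  rewrite -mxrank_ker mxrankS //; apply/sub_kermxP.
  by rewrite mulmxBl mul1mx PP subrr.
by rewrite -{1}(mxrank1 K n) -{1}(subrK P 1%:M) addrC mxrank_add.
Qed.

(* The relation gives [S L = M^T G] for an invertible [G] with
   [G + G^T = L^T S L] (Wall's form on the image of [L M]); hence
   [(1 - M L)^T G = - G^T]. *)
Lemma det_1sub_wall_factored (n r : nat) (S : 'M[K]_n) (L : 'M[K]_(n, r))
    (M N : 'M[K]_(r, n)) (P : 'M[K]_(n, r)) : S^T = S -> S \in unitmx ->
  M *m P = 1%:M -> N *m L = 1%:M ->
  S *m (L *m M) + (L *m M)^T *m S = (L *m M)^T *m S *m (L *m M) ->
  \det (1%:M - L *m M) = (-1) ^+ r.
Proof.
move=> symS uS MP NL; rewrite trmx_mul => rel.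
(* Right multiplication of the relation by [P] cancels [M]; solving for [S *m L] then produces this
   [G]. *)
pose G : 'M_r := L^T *m S *m L - L^T *m S *m P.
have SL : S *m L = M^T *m G.
  have := congr1 (fun X => X *m P) rel.
  rewrite /= mulmxDl -!mulmxA MP mulmx1 => rel1.
  by rewrite /G mulmxBr -!mulmxA -rel1 addrK.
have ZSL m (Z : 'M_(m, n)) : Z *m S *m L = Z *m M^T *m G.
  by rewrite -!mulmxA SL.
have GG : G + G^T = L^T *m S *m L.
  have rel' : M^T *m (G + G^T) *m M = M^T *m (L^T *m S *m L) *m M.
    have := rel; rewrite !mulmxA SL.
    rewrite ZSL.
    have -> : M^T *m L^T *m S = M^T *m G^T *m M.
      by rewrite -mulmxA -{1}symS -trmx_mul SL trmx_mul trmxK mulmxA.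
    by move=> rel2; rewrite mulmxDr mulmxDl rel2.
  have := congr1 (fun X => P^T *m X *m P) rel'.
  by rewrite /= !mulmxA -trmx_mul MP trmx1 !mul1mx -!mulmxA MP !mulmx1 !mulmxA.
have detG : \det G != 0.
  have : N *m (invmx S *m M^T) *m G = 1%:M by rewrite -!mulmxA -SL mulKmx.
  move/(congr1 determinant)/eqP; rewrite det_mulmx det1 => h.
  by apply: contraTneq h => ->; rewrite mulr0 eq_sym oner_eq0.
have key : (1%:M - M *m L)^T *m G = - G^T.
  rewrite [X in X *m G]linearB /= tr_scalar_mx trmx_mul mulmxBl mul1mx -mulmxA -SL mulmxA -GG.
  by rewrite opprD addrA subrr sub0r.
apply: (mulIf detG); rewrite det_sub_mulmxC -det_tr -det_mulmx key.
by rewrite -scaleN1r detZ det_tr.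
Qed.

(** For [a = 1 + v] the relation says that [v] is an isometry of [S], and [1 - a = - v]. A rank
    factorisation of [a] leads to the factored form. *)
Lemma det_1sub_wall (n : nat) (S a : 'M[K]_n) :
  S^T = S -> S \in unitmx -> S *m a + a^T *m S = a^T *m S *m a ->
  \det (1%:M - a) = (-1) ^+ \rank a.
Proof.
move=> symS uS; rewrite -{1 2 3 4 5}(mulmx_base a).
have /row_freeP[P MP] : row_free (row_base a) by exact: row_base_free.
have /row_fullP[N NL] : row_full (col_base a) by exact: col_base_full.
exact: (det_1sub_wall_factored symS uS MP NL).
Qed.

Lemma alternating_unit (s : nat) : ~~ odd s ->
  exists2 J : 'M[K]_s, J \in unitmx & J^T = - J.
Proof.
move=> es; have -> : s = (s./2 + s./2)%N by rewrite addnn even_halfK.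
exists (block_mx 0 1%:M (- 1%:M) 0).
  have : block_mx 0 1%:M (- 1%:M) 0 *m block_mx 0 (- 1%:M) 1%:M 0 = 1%:M :> 'M[K]_(s./2 + s./2).
    rewrite mulmx_block !(mul1mx, mulmx1, mulmx0, mul0mx, addr0, add0r).
    by rewrite mulNmx mulmxN opprK mul1mx -scalar_mx_block.
  by case/mulmx1_unit.
by rewrite tr_block_mx !trmx0 linearN /= tr_scalar_mx opp_block_mx oppr0 opprK.
Qed.

Lemma factored_idem (n r : nat) (V P : 'M[K]_(n, r)) (W N : 'M[K]_(r, n)) :
  W *m P = 1%:M -> N *m V = 1%:M -> V *m W *m (V *m W) = V *m W -> W *m V = 1%:M.
Proof.
move=> WP NV /(congr1 (fun X => N *m X *m P)) /=.
by rewrite !mulmxA NV mul1mx -!mulmxA WP mulmx1.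
Qed.

(* [S^-1 W^T J W] is the pullback of the alternating form [J] along
   [Q = V W], [W V = 1]. *)
Lemma even_rank_skew (n : nat) (S Q : 'M[K]_n) :
  S^T = S -> S \in unitmx -> Q *m Q = Q -> ~~ odd (\rank Q) ->
  let adj X := invmx S *m X^T *m S in
  exists k l, [/\ adj Q *m k = k, k *m Q = k, Q *m l = l, l *m adj Q = l &
    [/\ k *m l = adj Q, l *m k = Q & adj k = - k]].
Proof.
move=> symS uS QQ evQ adj.
have [J uJ skJ] := alternating_unit evQ.
have : exists V W, Q = V *m W /\ W *m V = 1%:M :> 'M_(\rank Q).
  exists (col_base Q), (row_base Q); split; first by rewrite mulmx_base.
  have /row_freeP[P MP] : row_free (row_base Q) by exact: row_base_free.
  have /row_fullP[N NL] : row_full (col_base Q) by exact: col_base_full.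
  by apply: (factored_idem MP NL); rewrite mulmx_base.
move: (\rank Q) J uJ skJ {evQ} => r J uJ skJ [V [W [QVW WV]]].
have VW : V^T *m W^T = 1%:M by rewrite -trmx_mul WV trmx1.
have adjQ : adj Q = invmx S *m W^T *m (V^T *m S).
  by rewrite /adj QVW trmx_mul !mulmxA.
exists (invmx S *m W^T *m (J *m W)), (V *m invmx J *m (V^T *m S)).
rewrite adjQ QVW; split.
- by rewrite -!mulmxA (mulmxA S) mulmxV // mul1mx (mulmxA V^T) VW mul1mx.
- by rewrite -!mulmxA (mulmxA W V) WV mul1mx.
- by rewrite -!mulmxA (mulmxA W V) WV mul1mx.
- by rewrite -!mulmxA (mulmxA S) mulmxV // mul1mx (mulmxA V^T) VW mul1mx.
split.
- by rewrite -!mulmxA (mulmxA W V) WV mul1mx (mulmxA J) mulmxV // mul1mx.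
- by rewrite -!mulmxA (mulmxA S) mulmxV // mul1mx (mulmxA V^T) VW mul1mx mulKmx.
- rewrite /adj !trmx_mul trmxK trmx_inv symS skJ -!mulmxA mulVmx // mulmx1.
  by rewrite !(mulNmx, mulmxN).
Qed.

End MatrixLemmas.

(** * The field cut out by an idempotent *)

(** The corner [f B f] is a field with unit [f]. The inverse [z] may lie outside the corner, since
    [f z f] is then an inverse inside it. *)
Definition commutative_division_idem (B : pzRingType) (f : B) : Prop :=
  [/\ f * f = f, f <> 0,
      forall x y, f * x * f = x -> f * y * f = y -> x * y = y * x &
      forall x, f * x * f = x -> x <> 0 -> exists z, z * x = f].

Section CornerField.
Variables (B : pzRingType) (f : B) (Hf : commutative_division_idem f).

(** [Hf] is an argument so that the type [corner] carries the proof from which its field structure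
    is inferred. *)
Definition corner_pred (Hf : commutative_division_idem f) : {pred B} :=
  fun x => f * x * f == x.

Lemma corner_zmod_closed : zmod_closed (corner_pred Hf).
Proof.
split=> [|x y]; rewrite !unfold_in ?mulr0 ?mul0r // => /eqP fx /eqP fy.
by rewrite mulrBr mulrBl fx fy.
Qed.

HB.instance Definition _ :=
  GRing.isZmodClosed.Build B (corner_pred Hf) corner_zmod_closed.

Record corner := Corner {cval : B; cval_in : cval \in corner_pred Hf}.
HB.instance Definition _ := [isSub for cval].
HB.instance Definition _ := [Choice of corner by <:].
HB.instance Definition _ := [SubChoice_isSubZmodule of corner by <:].

Lemma cornerP (x : corner) : f * val x * f = val x.
Proof. by apply/eqP; case: x. Qed.

Lemma corner_left (x : B) : f * x * f = x -> f * x = x.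
Proof. by case: Hf => ff _ _ _ <-; rewrite !mulrA ff. Qed.

Lemma corner_right (x : B) : f * x * f = x -> x * f = x.
Proof. by case: Hf => ff _ _ _ <-; rewrite -!mulrA ff. Qed.

Lemma corner_mul_subproof (x y : corner) : val x * val y \in corner_pred Hf.
Proof.
apply/eqP; rewrite mulrA corner_left ?cornerP // -mulrA corner_right //.
exact: cornerP.
Qed.

Lemma corner_one_subproof : f \in corner_pred Hf.
Proof. have [ff _ _ _] := Hf; by rewrite unfold_in /corner_pred !ff. Qed.

Lemma corner_inv_subproof (x : B) : f * x * f \in corner_pred Hf.
Proof. have [ff _ _ _] := Hf; by rewrite unfold_in /corner_pred !mulrA ff -!mulrA ff. Qed.

Definition corner_mul (x y : corner) : corner :=
  Corner (corner_mul_subproof x y).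
Definition corner_one : corner := Corner corner_one_subproof.
Definition corner_inv (x : corner) : corner :=
  if x == 0 then 0 else
  Corner (corner_inv_subproof (xget 0 [set z | z * val x = f])).

Fact corner_mulA : associative corner_mul.
Proof. by move=> x y z; apply: val_inj; rewrite /= mulrA. Qed.
Fact corner_mulC : commutative corner_mul.
Proof.
by move=> x y; apply: val_inj; have [_ _ c _] := Hf; apply: c; exact: cornerP.
Qed.
Fact corner_mul1 : left_id corner_one corner_mul.
Proof. by move=> x; apply: val_inj; rewrite /= corner_left // cornerP. Qed.
Fact corner_mulDl : left_distributive corner_mul +%R.
Proof. by move=> x y z; apply: val_inj; rewrite /= mulrDl. Qed.
Fact corner_one_neq0 : corner_one != 0.
Proof. have [_ nz _ _] := Hf; by apply/eqP => /(congr1 val). Qed.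

HB.instance Definition _ := GRing.Zmodule_isComNzRing.Build corner
  corner_mulA corner_mulC corner_mul1 corner_mulDl corner_one_neq0.

Fact corner_mulV (x : corner) : x != 0 -> corner_inv x * x = 1.
Proof.
move=> nz; apply: val_inj; rewrite /= /corner_inv (negPf nz) /=.
have nz' : val x <> 0 by move=> x0; case/eqP: nz; apply: val_inj.
have [ff _ _ /(_ _ (cornerP x) nz')[z zx]] := Hf.
have zP := @xgetPex _ 0 [set t | t * val x = f] (ex_intro _ z zx).
by rewrite -mulrA (corner_left (cornerP x)) -mulrA zP.
Qed.

Fact corner_inv0 : corner_inv 0 = 0.
Proof. by rewrite /corner_inv eqxx. Qed.

HB.instance Definition _ := GRing.ComNzRing_isField.Build corner corner_mulV corner_inv0.

End CornerField.

Lemma corner_field (B : pzRingType) (f : B) : commutative_division_idem f ->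
  exists (K : fieldType) (v : K -> B),
    [/\ {morph v : x y / x + y}, {morph v : x y / x * y}, v 1 = f, injective v &
        forall b, f * b * f = b <-> exists x, v x = b].
Proof.
move=> Hf; exists (corner Hf : fieldType), val; split=> //.
- exact: val_inj.
- move=> b; split=> [/eqP fb | [x <-]]; last exact: cornerP.
  by exists (Corner fb).
Qed.

(** * Idempotents in semisimple rings *)

Lemma mulr_eqA (R : pzRingType) (a b c : R) :
  a * b = c -> forall t, a * (b * t) = c * t.
Proof. by move=> <- t; rewrite mulrA. Qed.

(** A simple factor is prime: the [x] in [e B] with [g B x = 0] form a two-sided ideal, which is
    zero or contains [e]. *)
Lemma simple_factor_mul0 (B : pzRingType) (e g h : B) : central e -> e * e = e ->
  simple_factor e -> e * g = g -> (forall b, g * b * h = 0) -> e * h = h ->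
  g = 0 \/ h = 0.
Proof.
move=> ce ee [_ simpe] eg gbh eh.
have [|x []|I0|Ie] := simpe (fun x => e * x = x /\ forall b, g * b * x = 0); rewrite //=.
- split=> [|x y [ex gx] [ey gy]|a x [ex gx]|a x [ex gx]].
  + by split=> [|b]; rewrite mulr0.
  + by split=> [|b]; rewrite mulrDr ?ex ?ey // gx gy addr0.
  + by split=> [|b]; rewrite mulrA; [rewrite ce -mulrA ex|rewrite -[g * b * a]mulrA gx].
  + by split=> [|b]; rewrite mulrA ?ex // gx mul0r.
- by right; apply: I0.
- by left; have [_ /(_ 1)] := Ie e ee; rewrite mulr1 -ce eg.
Qed.

Section Semisimple.
Variable B : pzRingType.
Hypothesis ssB : semisimple B.

(** Von Neumann regularity. Splitting [1 = b a + z] along [B a] and a complement, [a z = a - a b a]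
    lies in both summands. *)
Lemma semisimple_regular (a : B) : exists b, a * b * a = a.
Proof.
have [|L' [[_ _ LZ] disj dec]] := ssB (L := fun x => exists b, x = b * a).
  split=> [|x y [b ->] [c ->]|c x [b ->]]; first by exists 0; rewrite mul0r.
    by exists (b + c); rewrite mulrDl.
  by exists (c * b); rewrite mulrA.
have [_ [z [[b ->] Lz e1]]] := dec 1.
have az : a * z = a - a * b * a.
  by rewrite -{2}[a]mulr1 e1 mulrDr mulrA addrC addKr.
exists b; apply/esym/eqP; rewrite -subr_eq0 -az; apply/eqP; apply: disj; last exact: LZ.
by exists (1 - a * b); rewrite az mulrBl mul1r.
Qed.

Lemma semisimple_reflexive_inverse (e a : B) : central e -> e * e = e -> e * a = a ->
  exists h, [/\ e * h = h, a * h * a = a & h * a * h = h].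
Proof.
move=> ce ee ea; have [b aba] := semisimple_regular a.
have abab : a * (b * (a * b)) = a * b by rewrite !mulrA aba.
have ah : a * (e * (b * (a * b))) = a * b by rewrite mulrA -ce ea abab.
exists (e * (b * (a * b))); split; first by rewrite mulrA ee.
  by rewrite ah.
by rewrite -mulrA ah -!mulrA abab.
Qed.

(** Split [1 = y + z] along the union of the chain and a complement, with [y] in [L n]. For [x] in
    the union, [x z] lies in both summands, so [x = x y] is in [L n]. *)
Lemma semisimple_acc (L : nat -> B -> Prop) :
  (forall n, is_left_ideal (L n)) -> (forall n x, L n x -> L n.+1 x) ->
  exists n, forall m x, L m x -> L n x.
Proof.
move=> idL incL.
have mono m n x : (m <= n)%N -> L m x -> L n x.
  by move=> /subnK <-; elim: (n - m)%N => //= k IH /IH; exact: incL.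
have [|L' [idL' disj dec]] := ssB (L := fun x => exists n, L n x).
  split=> [|x y [m Lx] [n Ly]|a x [n Lx]].
  - by exists 0%N; case: (idL 0%N).
  - exists (maxn m n); case: (idL (maxn m n)) => _ + _; apply.
      exact: mono (leq_maxl m n) Lx.
    exact: mono (leq_maxr m n) Ly.
  - by exists n; case: (idL n) => _ _; apply.
have [y [z [[n Ly] Lz e1]]] := dec 1.
exists n => m x Lx; have [L0 LD LZ] := idL n.
have xE : x = x * y + x * z by rewrite -mulrDr -e1 mulr1.
suff xz : x * z = 0 by rewrite xE xz addr0; exact: LZ.
apply: disj; last by case: idL' => _ _; apply.
have [_ MD MZ] := idL (maxn m n); exists (maxn m n).
have -> : x * z = x + (- x) * y by rewrite {2}xE mulNr addrC addKr.
apply: MD; first exact: mono (leq_maxl m n) Lx.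
by apply/MZ/(mono _ _ _ (leq_maxr m n)).
Qed.

Lemma annihilator_left_ideal (b : B) : is_left_ideal (fun x => x * b = 0).
Proof.
split=> [|x y xb yb|a x xb]; first exact: mul0r.
  by rewrite mulrDl xb yb addr0.
by rewrite -mulrA xb mulr0.
Qed.

(** The left annihilators of the powers of [b] stabilise at some [n]. If [x b = 0], then [x a^n]
    annihilates [b^(n+1)], hence [b^n], and [x = x a^n b^n = 0]; this applies to [x = b a - 1]. *)
Lemma semisimple_dedekind (a b : B) : a * b = 1 -> b * a = 1.
Proof.
move=> ab1.
have [|n x|n stab] := semisimple_acc (L := fun n x => x * b ^+ n = 0).
- by move=> n; exact: annihilator_left_ideal.
- by move=> xb; rewrite exprSr mulrA xb mul0r.
have abn : a ^+ n * b ^+ n = 1.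
  by elim: n {stab} => [|n IH]; rewrite ?mulr1 // exprSr exprS mulrA -[_ * a * b]mulrA ab1 mulr1.
have inj x : x * b = 0 -> x = 0.
  move=> xb; rewrite -[x]mulr1 -abn mulrA; apply: (stab n.+1).
  by rewrite exprSr mulrA -[x * _ * _]mulrA abn mulr1.
by apply/eqP; rewrite -subr_eq0; apply/eqP/inj; rewrite mulrBl -mulrA ab1 mulr1 mul1r subrr.
Qed.

(* Idempotents satisfy the descending chain condition: a descending chain
   [g_n] gives an ascending chain of left annihilators. *)
Lemma idempotent_ind (P : B -> Prop) :
  (forall g, g * g = g ->
     (forall h, h * h = h -> g * h = h -> h * g = h -> h <> g -> P h) -> P g) ->
  forall g, g * g = g -> P g.
Proof.
move=> step g gg; apply: contrapT => nPg.
pose bad := {g : B | g * g = g /\ ~ P g}.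
have next (b : bad) : exists c : bad,
    [/\ sval b * sval c = sval c, sval c * sval b = sval c & sval c <> sval b].
  case: b => b [bb nPb] /=; apply: contrapT => noc; apply: nPb; apply: step => // h hh bh hb hb'.
  by apply: contrapT => nPh; apply: noc; exists (exist _ h (conj hh nPh)).
have [nxt nxtP] := choice next.
pose c n := iter n nxt (exist _ g (conj gg nPg) : bad).
have [|n x|n stab] := semisimple_acc (L := fun n x => x * sval (c n) = 0).
- by move=> n; exact: annihilator_left_ideal.
- by move=> x0; have [<- _ _] := nxtP (c n); rewrite mulrA x0 mul0r.
have [_ c2 c3] := nxtP (c n); apply: c3.
have [cc _] := svalP (c n.+1).
(* [1 - c (n+1)] annihilates [c (n+1)], hence [c n] by stability, which forces [c (n+1) = c n]. *)
have := stab n.+1 (1 - sval (c n.+1)); rewrite mulrBl mul1r cc subrr => /(_ erefl).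
by rewrite mulrBl mul1r c2 => /eqP; rewrite subr_eq0 => /eqP.
Qed.

Definition primitive (f : B) : Prop :=
  [/\ f * f = f, f <> 0 &
      forall g, g * g = g -> f * g = g -> g * f = g -> g = 0 \/ g = f].

(** With [x z x = x], the product [f z x] is an idempotent below [f]; it is nonzero because
    [x = x f z x]. *)
Lemma primitive_left_inv (f x : B) :
  primitive f -> x * f = x -> x <> 0 -> exists z, z * x = f.
Proof.
move=> [ff f0 fmin] xf x0; have [z xzx] := semisimple_regular x.
have zxzx : z * x * (z * x) = z * x by rewrite mulrA -[z * x * z]mulrA -mulrA xzx.
have [|||g0|gf] := fmin (f * (z * x)).
- by rewrite mulrA -[f * _ * f]mulrA -[z * x * f]mulrA xf -mulrA zxzx.
- by rewrite mulrA ff.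
- by rewrite -!mulrA xf.
- by case: x0; rewrite -xzx -[x * z * x]mulrA -{1}xf -mulrA g0 mulr0.
- by exists (f * z); rewrite -mulrA.
Qed.

Lemma primitive_right_inv (f w : B) :
  primitive f -> f * w = w -> w <> 0 -> exists z, w * z * f = f.
Proof.
move=> [ff f0 fmin] fw w0; have [z wzw] := semisimple_regular w.
exists z; have [|||h0|//] := fmin (w * z * f).
- by rewrite -!mulrA (mulr_eqA fw) 2!mulrA wzw.
- by rewrite !mulrA fw.
- by rewrite -mulrA ff.
by case: w0; rewrite -wzw -{2}fw mulrA h0 mul0r.
Qed.

Lemma idempotent_sub (g h : B) : g * g = g -> h * h = h -> g * h = h -> h * g = h ->
  [/\ (g - h) * (g - h) = g - h, g * (g - h) = g - h, (g - h) * g = g - h,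
      h * (g - h) = 0 & (g - h) * h = 0].
Proof.
move=> gg hh gh hg; have E1 : g * (g - h) = g - h by rewrite mulrBr gg gh.
have E2 : h * (g - h) = 0 by rewrite mulrBr hh hg subrr.
by split; rewrite // ?mulrBl ?gg ?hg ?gh ?hh ?subrr // E1 E2 subr0.
Qed.

(** A nonzero idempotent that is not primitive splits as [(g - h) + h] into two smaller orthogonal
    ones. *)
Lemma primitive_ind (P : B -> Prop) (e : B) : e * e = e ->
  P 0 -> (forall f, primitive f -> e * f = f -> P f) ->
  (forall g h, g * h = 0 -> h * g = 0 -> P g -> P h -> P (g + h)) ->
  forall g, g * g = g -> e * g = g -> P g.
Proof.
move=> ee P0 Pprim PD g gg; move: gg.
apply: (idempotent_ind (P := fun g => e * g = g -> P g)) => {}g gg IH eg.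
have [-> // | g0] := pselect (g = 0).
have [gp|] := pselect (primitive g); first exact: Pprim.
move=> ngp; have [h [hh gh hg h0 hg']] : exists h,
    [/\ h * h = h, g * h = h, h * g = h, h <> 0 & h <> g].
  apply: contrapT => noh; apply: ngp; split=> // h hh gh hg.
  apply: contrapT => /not_orP[h0 hg']; apply: noh; by exists h.
have [E1 E2 E3 E4 E5] := idempotent_sub gg hh gh hg.
rewrite -[g](subrK h); apply: PD => //.
  apply: IH => //; last by rewrite mulrBr eg -gh mulrA eg.
  by move/eqP; rewrite -subr_eq0 addrC addKr oppr_eq0 => /eqP.
by apply: IH => //; rewrite -gh mulrA eg.
Qed.

Lemma primitive_corner_division (f : B) : primitive f ->
  (forall x y, f * x * f = x -> f * y * f = y -> x * y = y * x) ->
  commutative_division_idem f.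
Proof.
move=> pf comm; have [ff f0 _] := pf; split=> // x fx x0.
by apply: (primitive_left_inv pf) => //; rewrite -fx -!mulrA ff.
Qed.

(** An isomorphism of right modules between [g B] and [(f B)^n], in coordinates. *)
Definition frame (f g : B) : Prop :=
  exists (n : nat) (x y : 'I_n -> B),
    [/\ forall i, g * x i = x i /\ x i * f = x i,
        forall i, f * y i = y i /\ y i * g = y i,
        forall i j, y i * x j = if i == j then f else 0 &
        \sum_i x i * y i = g].

(** Simplicity gives a nonzero [w] in [f B g]. A right inverse [x0] of it makes [x0 w] an idempotent
    below [g] whose module is a copy of [f B]; the induction continues with [g - x0 w]. *)
Lemma simple_factor_frame (e f : B) : central e -> e * e = e ->
  simple_factor e -> primitive f -> e * f = f -> forall g, g * g = g -> e * g = g -> frame f g.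
Proof.
move=> ce ee simpe pf ef g gg; move: gg; have [ff f0 _] := pf.
apply: (idempotent_ind (P := fun g => e * g = g -> frame f g)) => {}g gg IH eg.
have [-> | g0] := pselect (g = 0).
  by exists 0%N, (fun=> 0), (fun=> 0); split; try (by case); rewrite big_ord0.
have [w [fw wg w0]] : exists w, [/\ f * w = w, w * g = w & w <> 0].
  apply: contrapT => now; have [b||/f0|/g0] // := simple_factor_mul0 ce ee simpe ef (h := g).
  apply: contrapT => fbg; apply: now; exists (f * b * g).
  by split; rewrite ?mulrA ?ff // -!mulrA gg.
have [z wzf] := primitive_right_inv pf fw w0.
pose x0 := g * z * f.
have gx0 : g * x0 = x0 by rewrite /x0 !mulrA gg.
have x0f : x0 * f = x0 by rewrite /x0 -!mulrA ff.
have wx0 : w * x0 = f by rewrite /x0 !mulrA wg wzf.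
pose h := x0 * w.
have hh : h * h = h by rewrite /h mulrA -[x0 * w * x0]mulrA wx0 x0f.
have gh : g * h = h by rewrite /h mulrA gx0.
have hg : h * g = h by rewrite /h -mulrA wg.
have wh : w * h = w by rewrite /h mulrA wx0 fw.
have hx0 : h * x0 = x0 by rewrite /h -mulrA wx0 x0f.
have [E1 E2 E3 E4 E5] := idempotent_sub gg hh gh hg.
have h0 : h <> 0 by move=> h0; apply: w0; rewrite -wh h0 mulr0.
have [||n [x [y [gx fy yx sxy]]]] := IH _ E1 E2 E3.
- by move/eqP; rewrite -subr_eq0 addrC addKr oppr_eq0 => /eqP.
- by rewrite mulrBr eg -gh mulrA eg.
pose cons0 (a : B) (b : 'I_n -> B) (i : 'I_n.+1) := oapp b a (unlift ord0 i).
have cons00 a b : cons0 a b ord0 = a by rewrite /cons0 unlift_none.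
have consS a b i : cons0 a b (lift ord0 i) = b i by rewrite /cons0 liftK.
exists n.+1, (cons0 x0 x), (cons0 w y); split.
- move=> i; case: (unliftP ord0 i) => [j|] ->; rewrite ?cons00 ?consS //.
  have [gxj xjf] := gx j; split=> //; by rewrite -gxj mulrA E2.
- move=> i; case: (unliftP ord0 i) => [j|] ->; rewrite ?cons00 ?consS //.
  have [fyj yjg] := fy j; split=> //; by rewrite -yjg -mulrA E3.
- move=> i j; case: (unliftP ord0 i) => [i'|] ->; case: (unliftP ord0 j) => [j'|] ->;
    rewrite ?cons00 ?consS.
  + by rewrite yx (inj_eq lift_inj).
  + rewrite eq_sym (negPf (neq_lift _ _)).
    by rewrite -(proj2 (fy i')) -hx0 -mulrA (mulr_eqA E5) mul0r mulr0.
  + rewrite (negPf (neq_lift _ _)).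
    by rewrite -(proj1 (gx j')) -wh -mulrA (mulr_eqA E4) mul0r mulr0.
  + by rewrite eqxx.
- rewrite big_ord_recl !cons00; under eq_bigr do rewrite !consS.
  by rewrite sxy -/h addrC subrK.
Qed.

End Semisimple.

(** * Skew forms and Cayley transforms *)

Section Involution.
Variables (B : pzRingType) (s : B -> B).
Hypothesis inv : is_involution s.

Lemma involD x y : s (x + y) = s x + s y. Proof. by case: inv. Qed.
Lemma involM x y : s (x * y) = s y * s x. Proof. by case: inv. Qed.
Lemma involK x : s (s x) = x. Proof. by case: inv. Qed.

Lemma invol0 : s 0 = 0.
Proof. by apply: (addrI (s 0)); rewrite -involD !addr0. Qed.

Lemma involN x : s (- x) = - s x.
Proof. by apply: (addrI (s x)); rewrite -involD !subrr invol0. Qed.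

Lemma involB x y : s (x - y) = s x - s y.
Proof. by rewrite involD involN. Qed.

Lemma invol1 : s 1 = 1.
Proof. by rewrite -[LHS]mulr1 -{2}(involK 1) -involM mulr1 involK. Qed.

Lemma invol_sum (I : Type) (r : seq I) (F : I -> B) :
  s (\sum_(i <- r) F i) = \sum_(i <- r) s (F i).
Proof. by apply: (big_morph s involD invol0). Qed.

Lemma invol_central e : central e -> central (s e).
Proof. by move=> ce x; rewrite -{1}[x]involK -involM -ce involM involK. Qed.

(* The right module [q B] carries a unimodular skew-hermitian form [k], with
   inverse [l]. *)
Definition skewable (q : B) : Prop :=
  exists k l, [/\ s q * k = k, k * q = k, q * l = l, l * s q = l &
    [/\ k * l = s q, l * k = q & s k = - k]].

Lemma skewable0 : skewable 0.
Proof. by exists 0, 0; rewrite ?(mulr0, invol0, oppr0); split. Qed.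

Lemma skewableD q1 q2 : q1 * q2 = 0 -> q2 * q1 = 0 ->
  skewable q1 -> skewable q2 -> skewable (q1 + q2).
Proof.
move=> q12 q21 [k1 [l1 [a1 b1 c1 d1 [e1 f1 g1]]]] [k2 [l2 [a2 b2 c2 d2 [e2 f2 g2]]]].
have s12 : s q1 * s q2 = 0 by rewrite -involM q21 invol0.
have s21 : s q2 * s q1 = 0 by rewrite -involM q12 invol0.
have z1 : s q1 * k2 = 0 by rewrite -a2 mulrA s12 mul0r.
have z2 : s q2 * k1 = 0 by rewrite -a1 mulrA s21 mul0r.
have z3 : k1 * q2 = 0 by rewrite -b1 -mulrA q12 mulr0.
have z4 : k2 * q1 = 0 by rewrite -b2 -mulrA q21 mulr0.
have z5 : q1 * l2 = 0 by rewrite -c2 mulrA q12 mul0r.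
have z6 : q2 * l1 = 0 by rewrite -c1 mulrA q21 mul0r.
have z7 : l1 * s q2 = 0 by rewrite -d1 -mulrA s12 mulr0.
have z8 : l2 * s q1 = 0 by rewrite -d2 -mulrA s21 mulr0.
have z9 : k1 * l2 = 0 by rewrite -b1 -mulrA z5 mulr0.
have z10 : k2 * l1 = 0 by rewrite -b2 -mulrA z6 mulr0.
have z11 : l1 * k2 = 0 by rewrite -d1 -mulrA z1 mulr0.
have z12 : l2 * k1 = 0 by rewrite -d2 -mulrA z2 mulr0.
exists (k1 + k2), (l1 + l2); rewrite !involD !mulrDl !mulrDr.
rewrite a1 b1 c1 d1 e1 f1 g1 a2 b2 c2 d2 e2 f2 g2.
rewrite z1 z2 z3 z4 z5 z6 z7 z8 z9 z10 z11 z12 !addr0 !add0r.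
by split=> //; split=> //; rewrite opprD.
Qed.

(* On the component [e], [u] is the generalised Cayley transform
   [y c^-1 s(y) - 1]; only the equation [c + s(c) = s(y) y] has to be preserved
   when lifting. *)
Definition cayley (e u : B) : Prop :=
  exists y c d, [/\ e * y = y, e * c = c, e * d = d, y * d * s y = e * (1 + u) &
    [/\ c * d = e, d * c = e & c + s c = s y * y]].

Lemma cayley_exchange e u : exchange_factor s e -> u * s u = 1 -> s u * u = 1 ->
  cayley e u.
Proof.
move=> [f [cf ff fsf -> _]] usu suu; set f' := s f.
have cf' : central f' by exact: invol_central.
have f'f' : f' * f' = f' by rewrite /f' -involM ff.
have f'f : f' * f = 0 by rewrite cf'.
pose p x y := f * x + f' * y.
have pM x y z t : p x y * p z t = p (x * z) (y * t).
  rewrite /p mulrDl !mulrDr !mulrA -[f * x * f]mulrA -[f * x * f']mulrA.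
  rewrite -[f' * y * f]mulrA -[f' * y * f']mulrA -!cf -!cf' !mulrA ff f'f' fsf f'f.
  by rewrite !mul0r addr0 add0r.
have pD x y z t : p x y + p z t = p (x + z) (y + t).
  by rewrite /p !mulrDr addrACA.
have sp x y : s (p x y) = p (s y) (s x).
  by rewrite /p involD !involM /f' involK -cf -[s x * s f]cf' addrC.
have p11 : f + f' = p 1 1 by rewrite /p !mulr1.
have pZ x y z : p x y * z = p (x * z) (y * z) by rewrite /p mulrDl !mulrA.
rewrite /cayley p11.
(* The second coordinate is read in [f' B], where the opposite of [x] appears as [f' s(x)]; hence
   [s u] in [c] and its inverse [u] in [d]. *)
exists (p (1 + u) 1), (p 1 (s u)), (p 1 u).
rewrite !pM !sp !pM !pD !pZ !mul1r !mulr1 !involD !invol1 involK mulrDr mulr1 usu suu.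
by split=> //; [rewrite mulr1 [u + 1]addrC | split=> //; rewrite mul1r [s u + 1]addrC].
Qed.

(** Wall's form sends [(a x, a z)] to [s(x) s(a) z]. Unitarity of [u] gives [a + s(a) = s(a) a], so
    the form plus its adjoint is the standard form on the image of [a]. The skew form [k] fills the
    complement without changing [c + s(c)]. *)
Lemma cayley_of_skewable e u h : central e -> e * e = e -> s e = e ->
  s u * u = 1 -> u * s u = 1 -> e * h = h ->
  let a := e * (1 + u) in
  a * h * a = a -> h * a * h = h -> skewable (e - a * h) -> cayley e u.
Proof.
move=> ce ee se suu usu eh a aha hah [k [l [qk kq ql lq [kl lk sk]]]].
set q := e - a * h in qk kq ql lq kl lk.
have ea : e * a = a by rewrite /a mulrA ee.
have he : h * e = h by rewrite -ce.
have sa : s a = e * (1 + s u) by rewrite /a involM involD invol1 se ce.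
have esa : e * s a = s a by rewrite sa mulrA ee.
have mulE x y : e * x * (e * y) = e * (x * y).
  by rewrite mulrA -[e * x * e]mulrA -ce !mulrA ee.
have asa : a + s a = a * s a.
  rewrite sa /a mulE -mulrDr; congr (e * _); rewrite mulrDl mul1r mulrDr mulr1 usu.
  by rewrite addrC [u + 1]addrC.
have saa : a + s a = s a * a.
  rewrite sa /a mulE -mulrDr; congr (e * _); rewrite mulrDl mul1r mulrDr mulr1 suu.
  by rewrite [s u + 1]addrC.
rewrite /cayley -/a; clearbody a.
(* [s a = a s(a) - a] lies in the image of [a], which [a h] fixes. *)
have psa : a * h * s a = s a.
  by rewrite -[s a](addKr a) asa mulrDr mulrN aha mulrA aha.
have saha : s a * h * a = s a.
  have -> : s a = s a * a - a by rewrite -saa addrC addKr.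
  by rewrite !mulrBl aha -!mulrA [a * (h * a)]mulrA aha.
have asp : a * s (a * h) = a by rewrite -[RHS]involK -psa [in RHS]involM involK.
have qa : q * a = 0 by rewrite /q mulrBl ea aha subrr.
have qsa : q * s a = 0 by rewrite /q mulrBl esa psa subrr.
have hq : h * q = 0 by rewrite /q mulrBr he mulrA hah subrr.
have asq : a * s q = 0 by rewrite -[a]involK -involM qsa invol0.
have sqsh : s q * s h = 0 by rewrite -involM hq invol0.
have eq : e * q = q by rewrite /q mulrBr ee mulrA ea.
have ek : e * k = k by rewrite -qk mulrA -{1}se -involM -ce eq.
have sps : s (a * h) + s q = e by rewrite -involD /q addrC subrK se.
have hash : e * (s h * s a * h) = s h * s a * h.
  by rewrite !mulrA -[e in e * s h]se -involM he.
have hl : h * l = 0 by rewrite -ql mulrA hq mul0r.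
have ka : k * a = 0 by rewrite -kq -mulrA qa mulr0.
have ak : a * k = 0 by rewrite -qk mulrA asq mul0r.
have lsh : l * s h = 0 by rewrite -lq -mulrA sqsh mulr0.
(* [a h] projects onto the image of [a]. There [s h * s a * h] is Wall's form and [a] inverts it;
   [k] and [l] are the mutually inverse parts on the complement. *)
exists (a * h), (s h * s a * h + k), (a + l); split.
- by rewrite mulrA ea.
- by rewrite mulrDr hash ek.
- by rewrite mulrDr ea -ql mulrA eq.
- by rewrite mulrDr mulrDl aha asp -[a * h * l]mulrA hl mulr0 mul0r addr0.
split.
- rewrite mulrDl !mulrDr ka kl -!mulrA hl !mulr0 addr0 add0r.
  by rewrite (mulrA (s a)) saha -involM sps.
- rewrite mulrDl !mulrDr ak lk addr0 !mulrA lsh !mul0r add0r.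
  have -> : a * s h * s a = a.
    by rewrite -mulrA -involM asp.
  by rewrite /q addrC subrK.
- rewrite involD sk !involM !involK addrACA subrr addr0 -!mulrA -mulrDr -mulrDl.
  by rewrite addrC saa !mulrA.
Qed.

Section Semisimple.
Hypothesis ssB : semisimple B.

(** Primitivity gives a left inverse of [k]; applying [s] to it and using [s k = k] or [s k = - k]
    gives a right inverse. *)
Lemma primitive_form_inv f k : primitive f -> s f * k = k -> k * f = k ->
  k <> 0 -> s k = k \/ s k = - k ->
  exists l, [/\ f * l = l, l * s f = l, l * k = f & k * l = s f].
Proof.
move=> pf fk kf k0 sk; have [ff _ _] := pf.
have [l0 l0k] := primitive_left_inv ssB pf kf k0.
pose l := f * l0 * s f.
have lk : l * k = f by rewrite /l -mulrA fk -mulrA l0k ff.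
have fl : f * l = l by rewrite /l !mulrA ff.
have lf : l * s f = l by rewrite /l -mulrA -involM ff.
have fsl : f * s l = s l by rewrite -{1}[f]involK -involM lf.
have [m [km fm]] : exists m, k * m = s f /\ f * m = m.
  have sksl : s k * s l = s f by rewrite -involM lk.
  case: sk => sk; first by exists (s l); rewrite -{1}sk.
  by exists (- s l); rewrite !mulrN fsl -sksl sk mulNr.
exists l; split=> //.
have -> : l = m by rewrite -lf -km mulrA lk.
by [].
Qed.

Lemma primitive_skewable f k : primitive f -> s f * k = k -> k * f = k ->
  k <> 0 -> s k = - k -> skewable f.
Proof.
move=> pf fk kf k0 sk.
have [l [fl lf lk kl]] := primitive_form_inv pf fk kf k0 (or_intror sk).
by exists k, l.
Qed.

Lemma skewable_dichotomy e : e * e = e ->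
  (forall g, g * g = g -> e * g = g -> skewable g) \/
  exists f, [/\ primitive f, e * f = f &
    forall x, s f * x = x -> x * f = x -> s x = x].
Proof.
move=> ee; have [all|] := pselect (forall f, primitive f -> e * f = f -> skewable f).
  left; apply: primitive_ind => //; first exact: skewable0.
  exact: skewableD.
move=> /existsNP[f /not_implyP[pf /not_implyP[ef nsk]]]; right; exists f; split=> // x fx xf.
apply/eqP; rewrite -subr_eq0; apply/eqP; apply: contrapT => nz; apply: nsk.
(* A nonzero [s x - x] would be a skew form on [f B], unimodular by primitivity. *)
apply: (primitive_skewable (k := s x - x)) => //.
- by rewrite mulrBr fx -involM xf.
- by rewrite mulrBl xf -[f]involK -involM fx.
- by rewrite involB involK opprB.
Qed.

End Semisimple.
End Involution.

(** * Orthogonal components *)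

Section OrthogonalFactor.
Variables (B : pzRingType) (s : B -> B).
Hypotheses (inv : is_involution s) (ssB : semisimple B).

(* A primitive [f] such that every sesquilinear form on [f B] is symmetric
   forces [f B f] to be a field: [k x y = s(x y) k = s(y) s(x) k = k y x]. *)
Lemma symmetric_primitive_orthogonal e f :
  central e -> e * e = e -> s e = e -> simple_factor e ->
  primitive f -> e * f = f -> (forall x, s f * x = x -> x * f = x -> s x = x) ->
  exists (K : fieldType) (n : nat) (phi : 'M[K]_n -> B) (S : 'M[K]_n),
    ring_iso_onto phi e /\ orthogonal_via phi S s.
Proof.
move=> ce ee se simpe pf ef symf; have [ff f0 _] := pf.
have sff : s f * s f = s f by rewrite -(involM inv) ff.
have [k [fk kf k0]] : exists k, [/\ s f * k = k, k * f = k & k <> 0].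
  apply: contrapT => nok.
  have [|b|sf0|] // := simple_factor_mul0 ce ee simpe (g := s f) (h := f) _ _ ef.
  - by rewrite -{1}se -(involM inv) -ce ef.
  - apply: contrapT => nz; apply: nok; exists (s f * b * f).
    by split; rewrite ?mulrA ?sff // -mulrA ff.
  - by apply: f0; rewrite -[f](involK inv) sf0 (invol0 inv).
have sk : s k = k by exact: symf.
have [l [fl lf lk kl]] := primitive_form_inv inv ssB pf fk kf k0 (or_introl sk).
have cornl x : f * x * f = x -> f * x = x by move=> <-; rewrite !mulrA ff.
have cornr x : f * x * f = x -> x * f = x by move=> <-; rewrite -!mulrA ff.
have kx x : f * x * f = x -> s x * k = k * x.
  move=> fx; rewrite -{1}sk -(involM inv); apply: symf; first by rewrite mulrA fk.
  by rewrite -mulrA cornr.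
have comm x y : f * x * f = x -> f * y * f = y -> x * y = y * x.
  move=> fx fy; have fxy : f * (x * y) * f = x * y.
    by rewrite mulrA cornl // -mulrA cornr.
  rewrite -[x in LHS](cornl x) // -[y in RHS](cornl y) // -lk -!mulrA; congr (l * _).
  rewrite -(kx _ fxy) (involM inv) -mulrA (kx _ fx) mulrA (kx _ fy) -mulrA.
  by [].
have [K [v [vD vM v1 vinj vP]]] := corner_field (primitive_corner_division ssB pf comm).
have v0 : v 0 = 0 by apply: (addrI (v 0)); rewrite -vD !addr0.
have vsum n (F : 'I_n -> K) : v (\sum_i F i) = \sum_i v (F i) by exact: (big_morph v vD v0).
have vf x : f * v x * f = v x by apply/vP; exists x.
pose w b : K := xget 0 [set x | v x = b].
have wK b : f * b * f = b -> v (w b) = b by move=> /vP; exact: xgetPex.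
have [n [x [y [gx fy yx sxy]]]] := simple_factor_frame ssB ce ee simpe pf ef ee ee.
have ex i : e * x i = x i by case: (gx i).
have xf i : x i * f = x i by case: (gx i).
have fy' i : f * y i = y i by case: (fy i).
have ye i : y i * e = y i by case: (fy i).
(* The frame makes an element of [e B] determined by its matrix entries [y i * z * x j]. *)
have ext z t : e * z = z -> e * t = t ->
    (forall i j, y i * z * x j = y i * t * x j) -> z = t.
  have E b : e * b = b -> b = \sum_i \sum_j x i * (y i * b * x j) * y j.
    move=> eb; have {1}-> : b = e * (b * e) by rewrite -ce eb eb.
    rewrite -{1 2}sxy.
    rewrite mulr_suml; apply: eq_bigr => i _.
    by rewrite !mulr_sumr; apply: eq_bigr => j _; rewrite !mulrA.
  move=> ez et zt; rewrite (E z) // (E t) //.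
  by apply: eq_bigr => i _; apply: eq_bigr => j _; rewrite zt.
pose phi (X : 'M[K]_n) := \sum_i \sum_j x i * v (X i j) * y j.
have ephi X : e * phi X = phi X.
  rewrite mulr_sumr; apply: eq_bigr => i _; rewrite mulr_sumr.
  by apply: eq_bigr => j _; rewrite !mulrA ex.
have yphi X i : y i * phi X = \sum_j v (X i j) * y j.
  rewrite /phi mulr_sumr (bigD1 i) //= [Z in _ + Z]big1 => [|i' ni].
    rewrite addr0 mulr_sumr; apply: eq_bigr => j _.
    by rewrite !mulrA yx eqxx cornl.
  rewrite mulr_sumr big1 // => j _.
  by rewrite !mulrA yx eq_sym (negPf ni) !mul0r.
have yphix X i j : y i * phi X * x j = v (X i j).
  rewrite yphi mulr_suml (bigD1 j) //= [Z in _ + Z]big1 => [|j' nj].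
    by rewrite addr0 -mulrA yx eqxx cornr.
  by rewrite -mulrA yx (negPf nj) mulr0.
have phiP z (X : 'M[K]_n) : e * z = z -> (forall i j, y i * z * x j = v (X i j)) -> phi X = z.
  by move=> ez zX; apply: ext => // i j; rewrite yphix zX.
(* Gram matrix of the values [s (x i) * x j], moved into [f B f] by [l]; [T] is the one of the dual
   family [y]. They are inverse because the [s (y t) * s (x t)] sum to [s e = e]. *)
pose S : 'M[K]_n := \matrix_(i, j) w (l * s (x i) * x j).
pose T : 'M[K]_n := \matrix_(i, j) w (y i * s (y j) * k).
have vS i j : v (S i j) = l * s (x i) * x j.
  by rewrite mxE wK // !mulrA fl -mulrA xf.
have vT i j : v (T i j) = y i * s (y j) * k.
  by rewrite mxE wK // !mulrA fy' -mulrA kf.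
have yf i : s (y i) * s f = s (y i) by rewrite -(involM inv) fy'.
have TS : T *m S = 1%:M.
  apply/matrixP => i j; apply: vinj; rewrite !mxE vsum.
  transitivity (y i * (\sum_t s (y t) * s (x t)) * x j).
    rewrite mulr_sumr mulr_suml; apply: eq_bigr => t _.
    by rewrite vM vT vS -!mulrA (mulr_eqA kl) !mulrA -[_ * _ * s f]mulrA yf.
  under eq_bigr do rewrite -(involM inv); rewrite -(invol_sum inv) sxy se ye yx.
  by case: eqP => _; rewrite ?v1 ?v0.
have [_ uS] := mulmx1_unit TS.
have invS : invmx S = T by rewrite -[LHS]mul1mx -TS mulmxK.
exists K, n, phi, S; split.
  split.
  - move=> X Y; apply: phiP; first by rewrite mulrDr !ephi.
    by move=> i j; rewrite mulrDr mulrDl !yphix mxE vD.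
  - move=> X Y; apply: phiP; first by rewrite mulrA ephi.
    move=> i j; rewrite -[in LHS](ephi Y) -sxy mulr_suml mulr_sumr mulr_sumr mulr_suml.
    rewrite mxE vsum; apply: eq_bigr => t _.
    by rewrite vM -!yphix !mulrA.
  - apply: phiP => // i j; rewrite ye yx mxE.
    by case: eqP => _; rewrite ?v1 ?v0.
  - move=> X Y XY; apply/matrixP => i j; apply: vinj; by rewrite -!yphix XY.
  - move=> z ez; exists (\matrix_(i, j) w (y i * z * x j)); apply: phiP => // i j.
    by rewrite mxE wK // !mulrA fy' -mulrA xf.
split=> //.
  apply/matrixP => i j; apply: vinj; rewrite mxE !vS.
  rewrite -!mulrA; congr (l * _); rewrite -{1}[x i](involK inv) -(involM inv).
  apply: symf; first by rewrite mulrA -(involM inv) xf.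
  by rewrite -mulrA xf.
move=> X; apply/esym/phiP.
  by rewrite -{1}se -(involM inv) -ce ephi.
move=> i j; rewrite invS mxE vsum (invol_sum inv) mulr_sumr mulr_suml.
apply: eq_bigr => c _; rewrite (invol_sum inv) mulr_sumr mulr_suml vM mxE vsum mulr_suml.
apply: eq_bigr => b _; rewrite vM vT vS mxE !(involM inv) -!mulrA; congr (_ * (_ * _)).
(* [k] and [l] conjugate an entry of [X], seen in the corner, to its image under [s]. *)
rewrite (mulrA k) -(kx _ (vf _)) !mulrA; congr (_ * _ * _).
by rewrite -[_ * k * l]mulrA kl -(involM inv) cornl.
Qed.

Lemma orthogonal_skewable (K : fieldType) (n : nat) (phi : 'M[K]_n -> B) (S U : 'M[K]_n)
    (e u h : B) :
  (forall x : B, x + x = 0 -> x = 0) -> central e -> s e = e -> e <> 0 ->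
  ring_iso_onto phi e -> orthogonal_via phi S s -> unitary s u ->
  phi U = e * u -> \det U = 1 -> e * h = h ->
  let a := e * (1 + u) in
  a * h * a = a -> skewable s (e - a * h).
Proof.
move=> two ce se e0 [phiD phiM phi1 phiI phiO] [symS uS phiS] uu phiU detU eh a aha.
have ee : e * e = e by rewrite -phi1 -phiM mul1mx.
have phi0 : phi 0 = 0 by apply: (addrI (phi 0)); rewrite -phiD !addr0.
have phiN X : phi (- X) = - phi X.
  by apply: (addrI (phi X)); rewrite -phiD !subrr phi0.
have [H phiH] := phiO _ eh.
pose A := 1%:M + U.
have phiA : phi A = a by rewrite phiD phi1 phiU /a mulrDr mulr1.
have SU : U^T *m S *m U = S.
  have : invmx S *m U^T *m S *m U = 1%:M.
    apply: phiI; rewrite phiM -phiS phi1 phiU (involM inv) se.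
    by rewrite mulrA -[s u * e * e]mulrA ee -ce -mulrA [s u * u]uu mulr1.
  by move=> /(congr1 (mulmx S)); rewrite !mulmxA mulmxV // mul1mx mulmx1.
have rel : S *m A + A^T *m S = A^T *m S *m A.
  have -> : A^T = 1%:M + U^T by rewrite raddfD /= tr_scalar_mx.
  rewrite /A !(mulmxDl, mulmxDr) !(mul1mx, mulmx1) SU.
  by rewrite [U^T *m S + S]addrC.
(* [det (1 - A) = det (- U) = (-1)^n], while Wall's relation gives [(-1)^(rank A)]. The signs decide
   parity because [-1 = 1] in [K] would give [e + e = 0]. *)
have parity : odd (\rank A) = odd n.
  have := det_1sub_wall symS uS rel.
  rewrite /A opprD addrA subrr sub0r -scaleN1r detZ detU mulr1 => /esym.
  rewrite -signr_odd -[in RHS]signr_odd.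
  have N1 : (-1 : K) != 1.
    apply/eqP => N1; apply: e0; apply: two; rewrite -phi1 -phiD -phi0; congr phi.
    by rewrite -scalemx1 -scalerDl -{1}N1 addrC subrr scale0r.
  case: odd; case: odd => //; rewrite !expr1 !expr0 => /eqP; first by rewrite (negPf N1).
  by rewrite eq_sym (negPf N1).
pose P := A *m H.
have phiP : phi P = a * h by rewrite phiM phiA phiH.
have AHA : P *m A = A by apply: phiI; rewrite phiM phiP phiA.
have PP : P *m P = P by rewrite {2}/P mulmxA AHA.
have rP : \rank P = \rank A.
  by apply/eqP; rewrite eqn_leq mxrankM_maxl -{1}AHA mxrankM_maxl.
pose Q := 1%:M - P.
have QQ : Q *m Q = Q.
  by rewrite /Q mulmxBl mul1mx mulmxBr mulmx1 PP subrr subr0.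
have phiQ : phi Q = e - a * h by rewrite phiD phiN phi1 phiP.
have evQ : ~~ odd (\rank Q).
  by rewrite mxrank_1sub_idem // rP oddB ?rank_leq_row // parity addbb.
have [k [l [h1 h2 h3 h4 [h5 h6 h7]]]] := even_rank_skew symS uS QQ evQ.
exists (phi k), (phi l); rewrite -phiQ !phiS -!phiM h1 h2 h3 h4 h5 h6 h7.
by split=> //; split.
Qed.

End OrthogonalFactor.

(** * Assembling the components and lifting *)

Lemma mulr_sum_orthogonal (R : pzRingType) (t : nat) (e a b : 'I_t -> R) :
  (forall i, central (e i)) -> (forall i j, i != j -> e i * e j = 0) ->
  (forall i, e i * a i = a i) -> (forall i, e i * b i = b i) ->
  (\sum_i a i) * (\sum_i b i) = \sum_i a i * b i.
Proof.
move=> ce eo ea eb; rewrite mulr_suml; apply: eq_bigr => i _.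
rewrite mulr_sumr (bigD1 i) //= big1 ?addr0 // => j ji.
by rewrite -(ea i) -(eb j) ce -mulrA [e i * _]mulrA eo 1?eq_sym // mul0r mulr0.
Qed.

Lemma cayley_sum (R : pzRingType) (s : R -> R) (u : R) (t : nat) (e : 'I_t -> R) :
  is_involution s -> (forall i, central (e i) /\ e i * e i = e i) ->
  (forall i j, i != j -> e i * e j = 0) -> (forall i, s (e i) = e i) ->
  (forall i, cayley s (e i) u) -> cayley s (\sum_i e i) u.
Proof.
move=> inv ce eo se cay; have cen i := proj1 (ce i).
have [y yP] := choice cay; have [c cP] := choice yP; have [d dP] := choice cP.
have ey i : e i * y i = y i by case: (dP i).
have ec i : e i * c i = c i by case: (dP i).
have ed i : e i * d i = d i by case: (dP i).
have esy i : e i * s (y i) = s (y i) by rewrite -{1}se -(involM inv) -cen ey.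
have eyd i : e i * (y i * d i) = y i * d i by rewrite mulrA ey.
have mulE := mulr_sum_orthogonal cen eo.
have absorb a : (forall i, e i * a i = a i) -> (\sum_i e i) * (\sum_i a i) = \sum_i a i.
  move=> ea; rewrite mulE //; last by move=> i; case: (ce i).
  by apply: eq_bigr.
exists (\sum_i y i), (\sum_i c i), (\sum_i d i).
rewrite !(involM, invol_sum inv) !absorb // !mulE //; split=> //.
  by rewrite mulr_suml; apply: eq_bigr => i _; case: (dP i).
split; first by apply: eq_bigr => i _; case: (dP i) => _ _ _ _ [].
  by apply: eq_bigr => i _; case: (dP i) => _ _ _ _ [].
by rewrite -big_split; apply: eq_bigr => i _; case: (dP i) => _ _ _ _ [].
Qed.

Lemma maximal_left_ideal_exists (R : pzRingType) (L : R -> Prop) :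
  is_left_ideal L -> ~ L 1 ->
  exists M, is_maximal_left_ideal M /\ forall x, L x -> M x.
Proof.
move=> idL L1.
(* [L] is adjoined to [X] so that the empty set, the union of the empty chain, is admissible. *)
pose proper (X : set R) := is_left_ideal (X `|` L) /\ ~ (X `|` L) 1.
have [|X [[idX X1] Xmax]] := @Zorn_bigcup _ proper.
  move=> F Fproper Ftot; split; last first.
    move=> [[X FX X1]|//]; have [_] := Fproper _ FX; apply; by left.
  have [L0 LD LZ] := idL.
  have subF X x : F X -> (X `|` L) x -> (\bigcup_(X in F) X `|` L) x.
    by move=> FX [Xx|]; [left; exists X|right].
  split; first by right.
  - have addX X x y : F X -> (X `|` L) x -> (X `|` L) y -> (\bigcup_(X in F) X `|` L) (x + y).
      move=> FX Xx Xy; have [[_ XD _] _] := Fproper _ FX.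
      by apply: (subF X) => //; exact: XD.
    move=> x y [[X FX Xx]|Lx] [[Y FY Yy]|Ly].
    + have [XY|YX] := Ftot _ _ FX FY.
        by apply: (addX Y) => //; left => //; exact: XY.
      by apply: (addX X) => //; left => //; exact: YX.
    + by apply: (addX X) => //; [left|right].
    + by apply: (addX Y) => //; [right|left].
    + by right; exact: LD.
  - move=> a x [[X FX Xx]|Lx]; last by right; exact: LZ.
    have [[_ _ XZ] _] := Fproper _ FX.
    by apply: (subF X) => //; apply: XZ; left.
exists (X `|` L); split; last by right.
split=> // M idM XM M1 x Mx.
have ML : M `|` L = M by apply/seteqP; split=> z; [case=> // Lz; apply: XM; right|left].
apply: contrapT => nXx; apply: (Xmax M); last by rewrite /proper ML.
split; first by move=> z Xz; apply: XM; left.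
by move=> MX; apply: nXx; left; exact: MX.
Qed.

Section JacobsonLifting.
Variables (A B : pzRingType) (pi : {rmorphism A -> B}).
Hypotheses (pi_surj : forall b, exists a, pi a = b)
  (pi_ker : forall a, pi a = 0 <-> jacobson a).

(** Otherwise [A x] lies in a maximal left ideal, which also contains [1 - x] from the radical,
    hence [1]. *)
Lemma lift_left_inverse (x : A) : pi x = 1 -> exists y, y * x = 1.
Proof.
move=> pix; apply: contrapT => noy.
have [||M [maxM LM]] :=
    @maximal_left_ideal_exists A (fun z => exists y, z = y * x).
- split=> [|z t [y ->] [y' ->]|a z [y ->]]; first by exists 0; rewrite mul0r.
    by exists (y + y'); rewrite mulrDl.
  by exists (a * y); rewrite mulrA.
- by move=> [y e1]; apply: noy; exists y.
have [[_ MD _] M1 _] := maxM.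
apply: M1; rewrite -[1](subrK x); apply: MD; last by apply: LM; exists 1; rewrite mul1r.
have /pi_ker : pi (1 - x) = 0 by rewrite rmorphB rmorph1 pix subrr.
by move/(_ M maxM).
Qed.

Lemma lift_inverse (c : A) (d : B) : pi c * d = 1 -> d * pi c = 1 ->
  exists c', c * c' = 1 /\ c' * c = 1.
Proof.
move=> cd dc; have [d' pid] := pi_surj d.
have [|y ydc] := @lift_left_inverse (d' * c); first by rewrite rmorphM pid.
have [|z zcd] := @lift_left_inverse (c * d'); first by rewrite rmorphM pid.
(* The left inverse [z] of [c d'] is congruent to 1, hence left invertible too,
   so [c d'] is a unit. *)
have [|w wz] := @lift_left_inverse z.
  have := congr1 pi zcd; by rewrite !rmorphM rmorph1 pid cd mulr1.
have cdz : c * d' * z = 1.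
  by have -> : c * d' = w by rewrite -[LHS]mul1r -wz -mulrA zcd mulr1.
exists (d' * z); split; first by rewrite mulrA.
have : y * d' * c * (d' * z) = y * d' by rewrite -mulrA [c * _]mulrA cdz mulr1.
by rewrite -[y * d' * c]mulrA ydc mul1r => ->; rewrite -mulrA.
Qed.

Lemma lift_cayley (sigma : A -> A) (sigmab : B -> B) (h : A) (v : B) :
  is_involution sigma -> (forall a, sigmab (pi a) = pi (sigma a)) ->
  h * 2%:R = 1 -> 2%:R * h = 1 ->
  cayley sigmab 1 v -> exists u, unitary sigma u /\ pi u = v.
Proof.
move=> inv sp h2 h2' [y [c [d [_ _ _ yds [cd dc cc]]]]].
have [Y piY] := pi_surj y; have [C0 piC0] := pi_surj c.
have sh : sigma h = h.
  have s2 : sigma 2%:R = 2%:R by rewrite (involD inv) (invol1 inv).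
  by rewrite -[LHS]mul1r -h2 -mulrA -{1}s2 -(involM inv) h2 (invol1 inv) mulr1.
have hC x : h * x = x * h.
  rewrite -[x in LHS]mulr1 -h2' !mulrA -[h * x * _]mulrA mulr_natr -mulr_natl.
  by rewrite mulrA h2 mul1r.
have half x : h * x + h * x = x.
  by rewrite -mulrDl -[h + h](mulr_natr h 2) h2 mul1r.
(* The hermitian part is prescribed and the skew part comes from [C0]. Since [c + s c = s y * y],
   [C] still reduces to [c]. *)
pose C := h * (sigma Y * Y) + h * (C0 - sigma C0).
have piC : pi C = c.
  rewrite /C rmorphD !rmorphM rmorphB -!sp piY piC0 -cc -mulrDr addrACA subrr addr0.
  by rewrite mulrDr -piC0 -rmorphM -rmorphD half.
have CC : C + sigma C = sigma Y * Y.
  rewrite /C !(involB inv, involD inv, involM inv, involK inv) sh -!hC addrACA half.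
  by rewrite -mulrDr addrA subrK subrr mulr0 addr0.
have [||D [CD DC]] := @lift_inverse C d; rewrite ?piC //.
have piD : pi D = d.
  by rewrite -[LHS]mul1r -dc -mulrA -piC -rmorphM CD rmorph1 mulr1.
exists (Y * D * sigma Y - 1); split; last first.
  rewrite rmorphB !rmorphM rmorph1 -sp piY piD yds mul1r addrC addKr.
  by [].
have sDC : sigma C * sigma D = 1 by rewrite -(involM inv) DC (invol1 inv).
have sCD : sigma D * sigma C = 1 by rewrite -(involM inv) CD (invol1 inv).
(* Substitute [sigma Y * Y = C + sigma C] and cancel against [D] and [sigma D]. *)
have key : sigma D * sigma Y * (Y * D) = D + sigma D.
  rewrite mulrA -[sigma D * _ * _]mulrA -CC mulrDr sCD mulrDl mul1r -mulrA CD mulr1.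
  by rewrite addrC.
have key' : Y * (sigma D * sigma Y) * (Y * D * sigma Y) =
    Y * D * sigma Y + Y * (sigma D * sigma Y).
  transitivity (Y * (sigma D * sigma Y * (Y * D)) * sigma Y); first by rewrite !mulrA.
  by rewrite key mulrDr mulrDl !mulrA.
rewrite /unitary (involB inv) (invol1 inv) !(involM inv) (involK inv).
by rewrite mulrBl mul1r mulrBr mulr1 key' addrK opprB addrC subrK.
Qed.

End JacobsonLifting.

Lemma U0_cayley (B : pzRingType) (s : B -> B) (v : B) :
  is_involution s -> semisimple B -> (forall x : B, x + x = 0 -> x = 0) ->
  U0 s v -> cayley s 1 v.
Proof.
move=> inv ssB two [uv [t [e [ce eo <- se det1]]]].
(* Unitarity inverts [v] on one side only; Dedekind finiteness gives the other. *)
have vu : v * s v = 1 by exact: semisimple_dedekind.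
apply: cayley_sum => // [i|i]; first by case: (se i).
have [cen ee] := ce i; have [sei [simpe|exch]] := se i; last exact: cayley_exchange.
set a := e i * (1 + v); have ea : e i * a = a by rewrite /a mulrA ee.
have [h [eh aha hah]] := semisimple_reflexive_inverse ssB cen ee ea.
apply: (cayley_of_skewable inv cen ee sei uv vu eh aha hah).
have [|||qq eq _ _ _] := idempotent_sub (h := a * h) ee.
- by rewrite mulrA aha.
- by rewrite mulrA ea.
- by rewrite -mulrA -cen eh.
have [all|[f [pf ef symf]]] := skewable_dichotomy inv ssB ee; first exact: all.
have [K [n [phi [S [iso orth]]]]] :=
  symmetric_primitive_orthogonal inv ssB cen ee sei simpe pf ef symf.
have [_ _ _ _ phiO] := iso.
have [U phiU] : exists U, phi U = e i * v by apply: phiO; rewrite mulrA ee.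
apply: (orthogonal_skewable inv two cen sei _ iso orth uv phiU) => //; first by case: simpe.
(* [U0] imposes determinant 1 for every orthogonal identification of the component, hence for the
   one just constructed. *)
exact: det1 iso orth _ phiU.
Qed.

(* The quotient A/Jac A is given as a surjective ring morphism pi : A -> B with
   kernel Jac A; sigmab is the induced involution on B. *)
Theorem theorem6 (A B : pzRingType) (sigma : A -> A) (sigmab : B -> B)
    (pi : {rmorphism A -> B}) :
  is_involution sigma ->
  (exists y : A, y * 2%:R = 1 /\ 2%:R * y = 1) ->
  (forall b : B, exists a : A, pi a = b) ->
  (forall a : A, pi a = 0 <-> jacobson a) ->
  semisimple B ->
  (forall a : A, sigmab (pi a) = pi (sigma a)) ->
  forall v : B, U0 sigmab v -> exists u : A, unitary sigma u /\ pi u = v.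
Proof.
move=> inv [h [h2 h2']] surj ker ssB sp v U0v.
apply: (lift_cayley surj ker inv sp h2 h2').
apply: U0_cayley => //; last first.
  move=> x xx; have := congr1 (fun z => pi h * z) xx.
  by rewrite /= mulr0 -mulr2n -mulr_natl -[2%:R](rmorph_nat pi) mulrA -rmorphM h2 rmorph1 mul1r.
split=> [x y|x y|x].
- have [a <-] := surj x; have [b <-] := surj y.
  by rewrite -rmorphD !sp (involD inv) rmorphD.
- have [a <-] := surj x; have [b <-] := surj y.
  by rewrite -rmorphM !sp (involM inv) rmorphM.
- by have [a <-] := surj x; rewrite !sp (involK inv).
Qed.
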